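(* Let $d\in\mathbb{N}$, $p\in[1,\infty]$, and for $n\in\mathbb{N}$ let $\vec a_n\in\mathbb{R}^d$, $b_n\in\mathbb{R}$ and $L_n(\vec\theta)=\vec a_n\cdot\vec\theta+b_n$ for $\vec\theta\in\mathbb{R}^d$. Put $R_n=|\vec a_n|_p$ and assume $0<R_1\le R_2\le\cdots$. Suppose there is $N\in\mathbb{N}$ such that $R_{n+N}/R_n\ge 2$ for every $n\in\mathbb{N}$. Let $$\delta=\frac{1}{2eN\left(\log_2(Nd)+4\log_2(\log_2(Nd)+30)\right)}.$$ Then the set $\{\vec\theta\in\mathbb{R}^d:\ \inf_{n\in\mathbb{N}}\|L_n(\vec\theta)\|\ge\delta\}$ is non-empty. Moreover, the set $\{\vec\theta\in\mathbb{R}^d:\ \liminf_{n\to\infty}\|L_n(\vec\theta)\|\ge\delta\}$ is everywhere dense in $\mathbb{R}^d$.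
   Context: For $x\in\mathbb{R}$, $\|x\|=\min_{k\in\mathbb{Z}}|x-k|$ is the distance to the nearest integer. For $\vec a=(a_1,\dots,a_d)\in\mathbb{R}^d$, $|\vec a|_p=(\sum_{i=1}^d|a_i|^p)^{1/p}$ for $p<\infty$ and $|\vec a|_\infty=\max_i|a_i|$. *)

(* Defs.v *)
From mathcomp Require Import all_boot all_order all_algebra.
From mathcomp Require Import all_classical all_reals all_analysis.
From mathcomp Require Import lra.

Set Implicit Arguments.
Unset Strict Implicit.
Unset Printing Implicit Defensive.

Import Order.TTheory GRing.Theory Num.Theory.
Import numFieldNormedType.Exports.

Local Open Scope classical_set_scope.
Local Open Scope ring_scope.

Definition log2 (R : realType) (x : R) : R := ln x / ln 2.

Definition dist_int (R : realType) (x : R) : R :=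
  inf (range (fun k : int => `|x - k%:~R|)).

(* The infimum in [dist_int] is a minimum. *)
Lemma dist_int_min (R : realType) (x : R) :
  (exists k : int, dist_int x = `|x - k%:~R|) /\
  (forall k : int, dist_int x <= `|x - k%:~R|).
Proof.
set A := range (fun k : int => `|x - k%:~R|).
have lbA : has_lbound A by exists 0 => _ [k _ <-].
split; last by move=> k; apply: ge_inf => //; exists k.
set m := Num.floor x.
have mx : m%:~R <= x by exact: floor_le.
have xm : x < m%:~R + 1 by have := floorD1_gt x; rewrite intrD.
pose k0 := if x - m%:~R <= m%:~R + 1 - x then m else m + 1.
exists k0; apply/eqP; rewrite eq_le; apply/andP; split.
  by apply: ge_inf => //; exists k0.
apply: lb_le_inf; first by exists `|x - 0%:~R|, 0.
move=> _ [k _ <-].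
have k0x : `|x - k0%:~R| <= x - m%:~R /\ `|x - k0%:~R| <= m%:~R + 1 - x.
  by rewrite /k0; case: ifPn => [h|/negP/negP]; rewrite -?ltNge ?intrD !ler_norml => *;
    split; apply/andP; split; lra.
have [km|mk] := leP k m.
  have kmR : k%:~R <= m%:~R :> R by rewrite ler_int.
  have := ler_norm (x - k%:~R); lra.
have mkR : m%:~R + 1 <= k%:~R :> R.
  by rewrite -[1 in X in X <= _]/(1%:~R) -intrD ler_int lezD1.
have := ler_norm (- (x - k%:~R)); rewrite normrN; lra.
Qed.

(* Meant for 1 <= p <= +oo. The library norm [`|a|] of a matrix is the largest
   absolute value of its entries. *)
Definition lp_norm (R : realType) (d : nat) (p : \bar R) (a : 'rV[R]_d) : R :=
  match p with
  | r%:E => (\sum_(i < d) `|a ord0 i| `^ r) `^ r^-1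
  | +oo%E => `|a|
  | -oo%E => 0
  end.

Definition affine_form (R : realType) (d : nat) (a : 'rV[R]_d) (b : R)
    (theta : 'rV[R]_d) : R :=
  \sum_(i < d) a ord0 i * theta ord0 i + b.

Definition delta (R : realType) (N d : nat) : R :=
  1 / (2 * expR 1 * N%:R *
       (log2 (N * d)%:R + 4 * log2 (log2 (N * d)%:R + 30))).

(* Main.v *)
(** The idea (Peres and Schlag, with a local lemma).  Rescaling [R_n] by
    [d^(1 - 1/p)] gives numbers [r_n] between the l1 norm of [a_n] and [d] times
    its largest entry.  Work in a cube, cut at time [n] into dyadic cells on which
    [L_n] varies by less than a small multiple [eps * delta] of [delta], and
    enlarge the bad set [||L_n|| < delta] to a union of such cells.  For [h = N k]
    with [k] close to [log2 (N d) + 4 log2 (log2 (N d) + 30) - 2], the form [L_n]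
    equidistributes along a coordinate direction in every cell of time [n - h], so
    that the bad set of time [n] fills at most the fraction
    [2 delta (1 + eps)^2 <= 1 / (e h)] of each of them.  The one-sided local lemma
    then leaves a positive proportion of the cells at every finite time, and
    compactness gives a point avoiding all bad sets.  A large cube serves the first
    claim; a small cube, from a late time on, serves density. *)

Require Import Defs.
From mathcomp Require Import all_boot all_order all_algebra.
From mathcomp Require Import all_classical all_reals all_analysis.
From mathcomp Require Import ring lra zify.

Set Implicit Arguments.
Unset Strict Implicit.
Unset Printing Implicit Defensive.

Import Order.TTheory GRing.Theory Num.Theory.
Import numFieldNormedType.Exports.

Local Open Scope classical_set_scope.
Local Open Scope ring_scope.

(** * Distance to the nearest integer *)

Section DistInt.
Context {R : realType}.
Implicit Types x y e : R.

Lemma dist_int_le x (k : int) : dist_int x <= `|x - k%:~R|.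
Proof. exact: (dist_int_min x).2. Qed.

Lemma dist_int_lt x e : dist_int x < e -> exists k : int, `|x - k%:~R| < e.
Proof. by have [[k ->] _] := dist_int_min x; exists k. Qed.

Lemma dist_int_ge0 x : 0 <= dist_int x.
Proof. by have [[k ->] _] := dist_int_min x. Qed.

Lemma dist_int_lipschitz x y : dist_int x <= dist_int y + `|x - y|.
Proof.
have [[k ->] _] := dist_int_min y.
apply: le_trans (dist_int_le x k) _.
have -> : x - k%:~R = (y - k%:~R) + (x - y) by ring.
exact: ler_normD.
Qed.

Lemma dist_int_le1 x : dist_int x <= 1.
Proof.
have xm := floor_le x; have := floorD1_gt x; rewrite intrD => xM.
by apply: le_trans (dist_int_le x (Num.floor x)) _; rewrite ler_norml; lra.
Qed.

Lemma dist_intN x : dist_int (- x) = dist_int x.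
Proof.
apply/eqP; rewrite eq_le; apply/andP; split.
  have [[k ->] _] := dist_int_min x.
  by apply: le_trans (dist_int_le _ (- k)) _; rewrite intrN -opprD normrN.
have [[k ->] _] := dist_int_min (- x).
by apply: le_trans (dist_int_le _ (- k)) _; rewrite intrN -normrN opprD opprK.
Qed.

End DistInt.

(** * Counting terms of an arithmetic progression near the integers *)

Section Counting.

Lemma count_le_sum (T : eqType) (P : pred T) (Q : nat -> pred T) (W V : nat)
    (s : seq T) :
    (forall x, x \in s -> P x -> exists2 k, (k < W)%N & Q k x) ->
    (forall k, (count (Q k) s <= V)%N) ->
  (count P s <= W * V)%N.
Proof.
move=> PQ QV; apply: (@leq_trans (\sum_(k < W) count (Q k) s)); last first.
  by rewrite -[X in (_ <= X * _)%N]card_ord -sum_nat_const leq_sum.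
elim: s PQ {QV} => [|x s IH] PQ //=.
rewrite big_split /= leq_add ?IH// => [|y ys]; last first.
  by apply: PQ; rewrite inE ys orbT.
case Px: (P x) => //.
have [|k kW Qk] := PQ x _ Px; first by rewrite inE eqxx.
by rewrite (bigD1 (Ordinal kW))//= Qk.
Qed.

Lemma count_iota_mul (P : pred nat) (J B : nat) : (0 < B)%N ->
  count (fun r => P (r %/ B)%N) (iota 0 (J * B)) = (B * count P (iota 0 J))%N.
Proof.
move=> B0; elim: J => [|J IH]; first by rewrite mul0n muln0.
rewrite mulSnr iotaD count_cat IH -addn1 iotaD count_cat mulnDr; congr addn.
rewrite !add0n /= addn0.
under eq_in_count => r.
  rewrite mem_iota => /andP[r1 r2].
  have -> : (r %/ B = J)%N.
    rewrite -(subnKC r1) divnMDl// divn_small ?addn0// ltn_subLR//.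
  over.
by case: (P J); rewrite ?count_predT ?count_pred0 ?size_iota ?muln1 ?muln0.
Qed.

Context {R : realType}.
Implicit Types tau c w e : R.

(** Two solutions differ by less than [w / tau], so all of them lie in a run of consecutive indices
    starting at the least one. *)
Lemma count_window tau c w J : 0 < tau -> 0 <= w ->
  (count (fun j : nat => (c < tau * j%:R < c + w)%R) (iota 0 J)
     <= (Num.truncn (w / tau)%R).+1)%N.
Proof.
move=> tau0 w0; set P := (fun j : nat => _).
have [/hasP[i iJ Pi]|noP] := boolP (has P (iota 0 J)); last first.
  by move: noP; rewrite has_count -leqNgt leqn0 => /eqP ->.
have exP : exists i, P i by exists i.
set m := ex_minn exP; have [Pm minP] : P m /\ (forall n, P n -> (m <= n)%N).
  by rewrite /m; case: ex_minnP.
rewrite -size_filter -(size_iota m (Num.truncn _).+1).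
apply: uniq_leq_size; first by rewrite filter_uniq ?iota_uniq.
move=> j; rewrite mem_filter mem_iota => /andP[Pj _].
have mj := minP _ Pj; rewrite mem_iota mj /= -ltn_subLR// ltnS.
rewrite truncn_ge_nat; last by rewrite divr_ge0// ltW.
rewrite ler_pdivlMr// natrB// mulrC mulrBr.
by move: Pm Pj; rewrite /P; lra.
Qed.

(** A union bound: at most [W] integers come within [e] of a term, and each one catches at most [V]
    indices. In [5 / 4], the [1] counts the first integer and [1 / 4] bounds [2 * e]. *)
Lemma count_dist_int tau c e J : 0 < tau -> 0 < e -> 2 * e <= 1 / 4 ->
  (count (fun j : nat => dist_int (tau * j%:R + c) < e) (iota 0 J))%:R
    <= (tau * J%:R + 5 / 4) * (2 * e / tau + 1).
Proof.
move=> tau0 e0 e4; set P := (fun j : nat => _).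
set W := Num.truncn (tau * J%:R + 5 / 4).
set V := (Num.truncn (2 * e / tau)).+1.
have J0 : 0 <= tau * J%:R by rewrite mulr_ge0// ltW.
have t0 : 0 <= 2 * e / tau by rewrite divr_ge0//; lra.
have cWV : (count P (iota 0 J) <= W * V)%N.
  set k0 := Num.floor (c - e) + 1.
  pose Q (i j : nat) := k0%:~R + i%:R - c - e < tau * j%:R
                        < k0%:~R + i%:R - c - e + 2 * e.
  apply: (@count_le_sum _ P Q) => [j jJ /dist_int_lt[k]|i]; last first.
    by apply: count_window => //; lra.
  rewrite ltr_norml => /andP[k1 k2].
  have j0 : 0 <= tau * j%:R by rewrite mulr_ge0// ltW.
  have k0k : k0 <= k.
    by rewrite /k0 lezD1 -(@ltr_int R) (le_lt_trans (floor_le _))//; lra.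
  have kE : k%:~R = k0%:~R + `|k - k0|%N%:R :> R.
    by rewrite natr_absz ger0_norm ?subr_ge0// rmorphB /= addrC subrK.
  exists `|k - k0|%N; last by rewrite /Q -kE; lra.
  rewrite /W -addn1 truncn_ge_nat; last lra.
  have k0c : c - e < k0%:~R by rewrite floorD1_gt.
  have : tau * j%:R + tau <= tau * J%:R.
    rewrite -[X in _ + X <= _]mulr1 -mulrDr ler_pM2l//.
    by rewrite -[X in _ + X]/(1%:R) -natrD ler_nat addn1; move: jJ; rewrite mem_iota.
  by rewrite natrD; lra.
apply: (@le_trans _ _ (W * V)%:R); first by rewrite ler_nat.
rewrite natrM ler_pM//; first by rewrite truncn_le; lra.
by rewrite /V -natr1 lerD2r truncn_le.
Qed.

Lemma count_dist_int_norm tau c e J : tau != 0 -> 0 < e -> 2 * e <= 1 / 4 ->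
  (count (fun j : nat => dist_int (tau * j%:R + c) < e) (iota 0 J))%:R
    <= (`|tau| * J%:R + 5 / 4) * (2 * e / `|tau| + 1).
Proof.
move=> tau0 e0 e4; have [tp|tn] := ltrP 0 tau.
  by rewrite gtr0_norm//; exact: count_dist_int.
have tn' : 0 < - tau by rewrite oppr_gt0 lt_neqAle tau0.
rewrite ler0_norm//.
under eq_count => j do rewrite -dist_intN opprD -mulNr.
by apply: count_dist_int.
Qed.

End Counting.

(** * The one-sided local lemma *)

(** This is [(1 + 1 / (h - 1)) ^ (h - 1) <= e], inverted. *)
Lemma expR_neg1_le (R : realType) (h : nat) : (1 < h)%N ->
  expR (- 1) <= (1 - h%:R^-1) ^+ h.-1 :> R.
Proof.
case: h => [//|[//|h]] _ /=.
have h0 : 0 < h.+1%:R :> R by [].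
have -> : 1 - h.+2%:R^-1 = (1 + h.+1%:R^-1)^-1 :> R.
  rewrite -[h.+2%:R]natr1; field; apply/andP; split; apply: lt0r_neq0; lra.
rewrite exprVn expRN lef_pV2 ?posrE ?expR_gt0 ?exprn_gt0 ?addr_gt0 ?invr_gt0//.
have <- : expR h.+1%:R^-1 ^+ h.+1 = expR 1 :> R.
  by rewrite -expRM_natl mulfV// gt_eqF.
by rewrite lerXn2r ?nnegrE ?expR_ge0 ?addr_ge0 ?invr_ge0 ?expR_ge1Dx.
Qed.

(* A one-sided Lovasz local lemma: [g n] is the measure of the points which
   avoid the first [n] events. *)
Lemma sieve_gt0 (R : realType) (g : nat -> R) (h m : nat) (q : R) :
    (1 < h)%N -> 0 <= q -> expR 1 * h%:R * q <= 1 -> 0 < g 0 ->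
    (forall n, (n < m)%N -> g n - q * g (n.+1 - h)%N <= g n.+1) ->
  0 < g m.
Proof.
move=> h1 q0 ehq g0 gS; set rho : R := 1 - h%:R^-1.
have h0 : 0 < h%:R :> R by rewrite ltr0n ltnW.
have rho0 : 0 < rho by rewrite subr_gt0 invf_lt1// ltr1n.
have rho1 : rho <= 1 by rewrite gerBl invr_ge0 ltW.
have chain n : (forall k, (k < n)%N -> rho * g k <= g k.+1) ->
    forall i j, (i + j <= n)%N -> rho ^+ j * g i <= g (i + j)%N.
  move=> gn i; elim=> [|j IH] ijn; first by rewrite expr0 mul1r addn0.
  rewrite addnS in ijn *; apply: le_trans (gn _ ijn).
  by rewrite exprS -mulrA ler_pM2l// IH// ltnW.
have pos n : (forall k, (k < n)%N -> rho * g k <= g k.+1) ->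
    forall i, (i <= n)%N -> 0 < g i.
  move=> gn i ik; have := chain n gn 0%N i ik.
  by apply: lt_le_trans; rewrite mulr_gt0// exprn_gt0.
(* The induction carries a ratio bound, stronger than positivity: each step keeps at least the
   proportion [rho]. *)
suff step n : (n <= m)%N -> forall k, (k < n)%N -> rho * g k <= g k.+1.
  exact: pos (step m _) _ _.
elim: n => [//|n IH] nm k; rewrite ltnS leq_eqVlt => /orP[/eqP ->|]; last first.
  by apply: IH; exact: ltnW.
have {}IH := IH (ltnW nm); set i := (n.+1 - h)%N.
have i_n : (i <= n)%N by rewrite /i; lia.
have gi0 : 0 < g i by exact: (pos n).
(* At most [h - 1] steps lead from [i] to [n], so at least [1 / e] of [g i] survives; thus
   [q * g i <= e * q * g n <= g n / h]. *)
have gin : expR (- 1) * g i <= g n.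
  have /= := chain n IH i (n - i)%N; rewrite subnKC// => /(_ (leqnn n)).
  apply: le_trans; rewrite ler_wpM2r ?(ltW gi0)//.
  apply: le_trans (expR_neg1_le R h1) _; rewrite -/rho.
  by apply: ler_wiXn2l => //; [exact: ltW|rewrite /i; lia].
apply: le_trans (gS n nm); rewrite -/i /rho mulrBl mul1r lerD2l lerN2.
rewrite -(@ler_pM2l _ (expR 1 * h%:R)) ?mulr_gt0 ?expR_gt0//.
have -> : expR 1 * h%:R * (h%:R^-1 * g n) = expR 1 * g n.
  by field; rewrite gt_eqF.
rewrite mulrA; apply: (@le_trans _ _ (g i)).
  by rewrite -[leRHS]mul1r ler_wpM2r// ltW.
rewrite -(@ler_pM2l _ (expR (- 1))) ?expR_gt0// (le_trans gin)//.
by rewrite mulrA expRN mulVf ?mul1r// gt_eqF ?expR_gt0.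
Qed.

(** * Averaging over blocks along one coordinate *)

Section Fiber.
Variables (d P B : nat) (i : 'I_d).
Hypothesis B_gt0 : (0 < B)%N.
Hypothesis BP : (B %| P.+1)%N.
Notation X := {ffun 'I_d -> 'I_P.+1}.
Implicit Type x : X.

(** Moves [x] along coordinate [i] inside its block of [B] consecutive values. Since [B] divides
    [P.+1], for [r < B] the argument of [inord] is in range and no default value occurs. *)
Definition set_low x (r : nat) : X :=
  [ffun j => if j == i then inord (x i %/ B * B + r) else x j].

Lemma set_low_at x r : (r < B)%N -> set_low x r i = (x i %/ B * B + r)%N :> nat.
Proof.
move=> rB; rewrite ffunE eqxx inordK//.
have : (x i %/ B < P.+1 %/ B)%N by rewrite ltn_divLR// divnK.
move=> xP; rewrite -[X in (_ < X)%N](divnK BP).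
apply: leq_trans (leq_mul xP (leqnn B)).
by rewrite mulSn addnC ltn_add2r.
Qed.

(** Data read off cells at least as coarse as the blocks are therefore constant along a fiber. *)
Lemma set_low_div x r j B' : (r < B)%N -> (B %| B')%N ->
  (set_low x r j %/ B' = x j %/ B')%N.
Proof.
move=> rB BB'; have [->|ji] := eqVneq j i; last by rewrite ffunE (negPf ji).
case/dvdnP: BB' => C ->; rewrite (mulnC C) !divnMA set_low_at// divnMDl//.
by rewrite (divn_small rB) addn0.
Qed.

Lemma set_low_low x r s : (r < B)%N -> (s < B)%N -> set_low (set_low x r) s = set_low x s.
Proof.
move=> rB sB; apply/ffunP => j; apply: val_inj => /=.
have [->|ji] := eqVneq j i; last by rewrite !ffunE (negPf ji).
by rewrite !set_low_at// divnMDl// (divn_small rB) addn0.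
Qed.

Lemma set_low_id x : set_low x (x i %% B) = x.
Proof.
apply/ffunP => j; apply: val_inj => /=.
have [->|ji] := eqVneq j i; last by rewrite !ffunE (negPf ji).
by rewrite set_low_at ?ltn_pmod// -divn_eq.
Qed.

(* Exchanging the low digits of [x i] with [r] is an involution of [(x, r)]. *)
Lemma sum_set_low (F : X -> nat) :
  (\sum_x F x * B = \sum_x \sum_(r < B) F (set_low x r))%N.
Proof.
transitivity (\sum_(u : X * 'I_B) F u.1)%N.
  rewrite -(pair_bigA _ (fun x _ => F x))/= ; apply: eq_bigr => x _.
  by rewrite sum_nat_const card_ord mulnC.
rewrite pair_bigA /=.
pose sw (u : X * 'I_B) := (set_low u.1 u.2, Ordinal (ltn_pmod (u.1 i) B_gt0)).
rewrite (reindex_inj (inv_inj (_ : involutive sw)))//=.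
move=> [x r]; rewrite /sw /=; congr pair.
  by rewrite set_low_low ?ltn_pmod// set_low_id.
by apply: val_inj; rewrite /= set_low_at// modnMDl modn_small.
Qed.

(** A conditional probability bound: [E] is a union of fibers, [A] fills at most the fraction [q] of
    each, and [sum_set_low] writes the count as an average over fibers. *)
Lemma fiber_count (R : realType) (q : R) (E A : pred X) :
    (forall x r, (r < B)%N -> E (set_low x r) = E x) ->
    (forall x, (count (fun r => A (set_low x r)) (iota 0 B))%:R <= q * B%:R) ->
  #|[pred x | E x && A x]|%:R <= q * #|E|%:R.
Proof.
move=> EB AB; rewrite -(@ler_pM2r _ B%:R) ?ltr0n//.
rewrite -natrM -sum1_card big_mkcond big_distrl /= sum_set_low.
rewrite -sum1_card mulrAC !natr_sum mulr_sumr [leRHS]big_mkcond /=.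
apply: ler_sum => x _; rewrite -topredE /=; have [Ex|nEx] := boolP (E x).
  rewrite mulr1; apply: le_trans (AB x); rewrite ler_nat.
  have -> : iota 0 B = index_iota 0 B by rewrite /index_iota subn0.
  rewrite -sum1_count big_mkord [X in (_ <= X)%N]big_mkcond leq_eqVlt.
  by apply/orP; left; apply/eqP/eq_bigr => r _; rewrite inE EB// Ex.
rewrite big1// => r _.
by rewrite inE EB// (negPf nEx).
Qed.

End Fiber.

(** * Dyadic cells and the fraction of bad ones *)

Section Cells.
Context {R : realType}.
Variable K : nat.

(* The center of the dyadic interval of length [2^-l] containing [t / 2^K]. *)
Definition dyadic_center (l t : nat) : R :=
  ((t %/ 2 ^ (K - l))%:R + 2^-1) / 2 ^+ l.

Lemma dyadic_center_close l t : (l <= K)%N ->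
  `|t%:R / 2 ^+ K - dyadic_center l t| <= 2^-1 / 2 ^+ l.
Proof.
move=> lK; rewrite /dyadic_center; set B := (2 ^ (K - l))%N.
have B0 : (0 < B)%N by rewrite expn_gt0.
have BR : 0 < B%:R :> R by rewrite ltr0n.
have l0 : 0 < 2 ^+ l :> R by rewrite exprn_gt0.
have -> : 2 ^+ K = 2 ^+ l * B%:R :> R by rewrite /B natrX -exprD subnKC.
rewrite {1}(divn_eq t B) natrD natrM.
set q := (t %/ B)%:R; set r := (t %% B)%N.
have rB : r%:R / B%:R <= 1 :> R by rewrite ler_pdivrMr// mul1r ler_nat ltnW// ltn_pmod.
have r0 : 0 <= r%:R / B%:R :> R by rewrite divr_ge0.
have -> : (q * B%:R + r%:R) / (2 ^+ l * B%:R) - (q + 2^-1) / 2 ^+ l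
    = (r%:R / B%:R - 2^-1) / 2 ^+ l :> R.
  by field; rewrite !gt_eqF.
rewrite normrM [X in _ * X]gtr0_norm ?invr_gt0// ler_pM2r ?invr_gt0//.
by rewrite ler_norml; lra.
Qed.

Variables (d P : nat).
Hypothesis PK : P.+1 = (2 ^ K)%N.
Notation X := {ffun 'I_d -> 'I_P.+1}.

(** Evaluation at the center depends only on the cell of level [l], so the enlarged bad sets become
    unions of cells. *)
Definition center_form (a : 'rV[R]_d) (b : R) (l : nat) (x : X) : R :=
  \sum_j a ord0 j * dyadic_center l (x j) + b.

(** Along coordinate [i], the centers of level [m] in a cell of level [l] give a progression of
    [2 ^ (m - l)] values with step [tau]. The last hypothesis makes it long enough for the rounding
    term [5 / 4] to be absorbed in [1 + eps]. *)
Lemma bad_cells_fraction (a : 'rV[R]_d) b (i : 'I_d) (l m : nat) (e eps : R) (x : X) :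
    (l <= m)%N -> (m <= K)%N -> 0 < e -> 2 * e <= 1 / 4 -> 0 <= eps ->
    5 / 4 <= eps * (`|a ord0 i| / 2 ^+ l) ->
  (count (fun r => dist_int (center_form a b m (set_low (2 ^ (K - l)) i x r)) < e)
     (iota 0 (2 ^ (K - l))))%:R
  <= (1 + eps) * (2 * e + `|a ord0 i| / 2 ^+ m) * (2 ^ (K - l))%:R.
Proof.
move=> lm mK e0 e4 eps0 ay; set B := (2 ^ (K - l))%N.
set B' := (2 ^ (K - m))%N; set J := (2 ^ (m - l))%N.
have BJ : B = (J * B')%N by rewrite /B /J /B' -expnD; congr expn; lia.
have B0 : (0 < B)%N by rewrite expn_gt0.
have B'0 : (0 < B')%N by rewrite expn_gt0.
have J0 : 0 < J%:R :> R by rewrite ltr0n expn_gt0.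
have m0 : 0 < 2 ^+ m :> R by rewrite exprn_gt0.
have l0 : 0 < 2 ^+ l :> R by rewrite exprn_gt0.
have mJ : 2 ^+ m = 2 ^+ l * J%:R :> R by rewrite /J natrX -exprD subnKC.
have a0 : a ord0 i != 0.
  by apply: contraTneq ay => ->; rewrite normr0 mul0r mulr0 -ltNge; lra.
have BP : (B %| P.+1)%N by rewrite PK /B dvdn_exp2l// leq_subr.
set tau := a ord0 i / 2 ^+ m.
have tauE : `|tau| = `|a ord0 i| / 2 ^+ m.
  by rewrite normrM [X in _ * X]gtr0_norm ?invr_gt0.
have tau0 : tau != 0 by rewrite mulf_neq0// invr_neq0 ?gt_eqF.
set c := tau * ((x i %/ B * J)%:R + 2^-1) +
         (\sum_(j | j != i) a ord0 j * dyadic_center m (x j) + b).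
have formE r : (r < B)%N ->
    center_form a b m (set_low B i x r) = tau * (r %/ B')%:R + c.
  move=> rB; rewrite /center_form (bigD1 i)//= /dyadic_center set_low_at//.
  rewrite -/B' {2}BJ mulnA divnMDl// natrD /c.
  under eq_bigr => j ji do rewrite ffunE (negPf ji).
  rewrite /tau /dyadic_center; set S := \sum_(_ | _) _.
  by field; rewrite gt_eqF.
under eq_in_count => r.
  rewrite mem_iota => /andP[_ rB]; rewrite formE//.
  over.
rewrite [in iota _ _]BJ (count_iota_mul (fun j => dist_int (tau * j%:R + c) < e))//.
rewrite BJ !natrM [leLHS]mulrC [leRHS]mulrA ler_pM2r ?ltr0n//.
apply: le_trans (count_dist_int_norm c J tau0 e0 e4) _.
have tau_gt0 : 0 < `|tau| by rewrite normr_gt0.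
rewrite -tauE; have yE : `|a ord0 i| / 2 ^+ l = `|tau| * J%:R.
  by rewrite tauE mJ; field; rewrite !gt_eqF.
have -> : (1 + eps) * (2 * e + `|tau|) * J%:R
    = ((1 + eps) * (`|tau| * J%:R)) * (2 * e / `|tau| + 1).
  by field; rewrite gt_eqF.
rewrite ler_wpM2r//; last by rewrite mulrDl mul1r -yE; lra.
by rewrite addr_ge0// divr_ge0//; lra.
Qed.

End Cells.

(** * Avoiding finitely many bad sets *)

Lemma dyadic_level (R : realType) (y : R) : 1 <= y ->
  exists l : nat, y <= 2 ^+ l < 2 * y.
Proof.
move=> y1; have ex : exists l, y <= 2 ^+ l.
  exists (Num.truncn y).+1; apply: ltW; apply: lt_le_trans (truncnS_gt y) _.
  by rewrite -natrX ler_nat ltnW// ltn_expl.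
case: (ex_minnP ex) => l yl lmin; exists l; rewrite yl /=.
case: l yl lmin => [|l] yl lmin; first by rewrite expr0; lra.
rewrite exprS ltr_pM2l// ltNge; apply/negP => /lmin.
by rewrite ltnn.
Qed.

Section Core.
Context {R : realType}.
Variables (d : nat) (a : nat -> 'rV[R]_d) (b r : nat -> R) (delta eps : R) (h : nat).
Hypothesis h_gt1 : (1 < h)%N.
Hypothesis d_gt0 : (0 < d)%N.
Hypothesis delta_gt0 : 0 < delta.
Hypothesis eps_gt0 : 0 < eps.
Hypothesis eps_le1 : eps <= 1.
Hypothesis delta_eps : 2 * delta * (1 + eps) <= 1 / 4.
Hypothesis sum_le_r : forall n, \sum_i `|a n ord0 i| <= r n.
Hypothesis r_le_max : forall n, exists i, r n <= d%:R * `|a n ord0 i|.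
Hypothesis r_mono : forall n, r n <= r n.+1.
Hypothesis r0_large : 5 / 4 * d%:R <= eps * r 0%N.
Hypothesis r_growth : forall n, 5 / 2 * d%:R * r n <= eps ^+ 2 * delta * r (n + h)%N.
Hypothesis lll : expR 1 * h%:R * (2 * delta * (1 + eps) ^+ 2) <= 1.

Let r_le m n : (m <= n)%N -> r m <= r n.
Proof.
move=> /subnK <-; elim: (n - m)%N => [|k IH]; first by rewrite add0n.
exact: le_trans IH (r_mono _).
Qed.

Let d_ge1 : 1 <= d%:R :> R. Proof. by rewrite ler1n. Qed.

Let r0_ge : 5 / 4 <= r 0%N.
Proof.
have r_ge0 : 0 <= r 0%N by apply: le_trans (sum_le_r 0%N); apply: sumr_ge0.
have : eps * r 0%N <= r 0%N by rewrite ler_piMl.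
have := d_ge1; have := r0_large; lra.
Qed.

Let r_gt0 n : 0 < r n.
Proof. by have := r_le (leq0n n); have := r0_ge; lra. Qed.

Let ed0 : 0 < eps * delta. Proof. exact: mulr_gt0. Qed.

Let level_ex n : exists l : nat, r n / (eps * delta) <= 2 ^+ l < 2 * (r n / (eps * delta)).
Proof.
apply: dyadic_level; rewrite ler_pdivlMr// mul1r.
have : eps * delta <= delta by rewrite ler_piMl// ltW.
have : 0 <= delta * eps by rewrite mulrC ltW.
have := r_le (leq0n n); have := r0_ge; have := delta_eps; rewrite mulrDr; lra.
Qed.

(** The form of index [n] varies by at most [eps * delta] on a cell of this level; the upper bound
    in [level_ex] keeps the cells from being needlessly small. *)
Let lev n := xchoose (level_ex n).

Let lev_ge n : r n <= eps * delta * 2 ^+ lev n.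
Proof.
by have /andP[+ _] := xchooseP (level_ex n); rewrite ler_pdivrMr// mulrC.
Qed.

Let lev_lt n : eps * delta * 2 ^+ lev n < 2 * r n.
Proof.
have /andP[_] := xchooseP (level_ex n); rewrite -/(lev n) mulrA ltr_pdivlMr//.
by rewrite mulrC.
Qed.

Let lev_le m n : (m <= n)%N -> (lev m <= lev n)%N.
Proof.
move=> mn; rewrite -ltnS -(ltn_exp2l _ _ (isT : (1 < 2)%N)) -(ltr_nat R) !natrX -(ltr_pM2l ed0).
rewrite exprS; have := lev_lt m; have := r_le mn; have := lev_ge n; lra.
Qed.

(** All events are read on cells of the finest level [K], where measure is cardinality; [sieve_gt0]
    shows that some cell survives. *)
Lemma finite_avoidance m : exists theta : 'rV[R]_d,
  (forall i, 0 <= theta ord0 i <= 1) /\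
  (forall n, (n < m)%N -> delta <= dist_int (affine_form (a n) (b n) theta)).
Proof.
set K := lev m; set P := (2 ^ K).-1.
have PK : P.+1 = (2 ^ K)%N by rewrite prednK// expn_gt0.
pose X := {ffun 'I_d -> 'I_P.+1}.
(* The excess over [delta] bounds the change of the form from the center to any point of the
   cell. *)
pose e n := delta + r n * (2^-1 / 2 ^+ lev n).
pose bad n (x : X) := dist_int (center_form K (a n) (b n) (lev n) x) < e n.
pose good n (x : X) := [forall j : 'I_n, ~~ bad j x].
pose g n : R := #|good n|%:R.
have pow0 l : 0 < 2 ^+ l :> R by rewrite exprn_gt0.
have e0 n : 0 < e n.
  by rewrite addr_gt0// mulr_gt0// divr_gt0.
have eE n : e n = delta + r n / 2 ^+ lev n / 2 by rewrite /e; ring.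
(* One [eps * delta] pays for the enlargement of the bad set, the other for the step of the
   progression. *)
have eS n : 2 * e n + r n / 2 ^+ lev n <= 2 * delta * (1 + eps).
  have : r n / 2 ^+ lev n <= eps * delta by rewrite ler_pdivrMr.
  rewrite eE; have -> : 2 * delta * (1 + eps) = 2 * delta + 2 * (eps * delta) by ring.
  by lra.
have e4 n : 2 * e n <= 1 / 4.
  have : 0 <= r n / 2 ^+ lev n by rewrite divr_ge0// ltW.
  by have := eS n; have := delta_eps; lra.
have g0 : 0 < g 0%N.
  rewrite ltr0n; apply/card_gt0P; exists [ffun=> ord0].
  by apply/forallP => -[].
set q := 2 * delta * (1 + eps) ^+ 2.
have q0 : 0 <= q by rewrite mulr_ge0 ?exprn_ge0 ?mulr_ge0 ?addr_ge0// ltW.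
have gS n : (n < m)%N -> g n - q * g (n.+1 - h)%N <= g n.+1.
  move=> nm; have nK : (lev n <= K)%N by apply: lev_le; exact: ltnW.
  set k := (n.+1 - h)%N.
  have [i ri] := r_le_max n.
  (* the bad event [n] is spread out in each cell of level [l] *)
  have [l [ln lk yl]] : exists l, [/\ (l <= lev n)%N, (forall j, (j < k)%N -> (lev j <= l)%N)
      & 5 / 4 <= eps * (`|a n ord0 i| / 2 ^+ l)].
    have dR : 0 < d%:R :> R by rewrite ltr0n.
    (* For [n < h] the truncated [k] is [0]: no earlier event matters and the whole cube, of level
       [0], serves as the cell. *)
    have [nh|hn] := leqP n.+1 h.
      exists 0%N; split => //; first by rewrite /k; move: nh; rewrite -subn_eq0 => /eqP ->.
      rewrite expr0 divr1 -(ler_pM2l dR) mulrC (le_trans r0_large)//.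
      rewrite mulrCA ler_pM2l// (le_trans _ ri)//; exact: r_le.
    exists (lev (n - h)%N); split; first by apply: lev_le; exact: leq_subr.
      by move=> j jk; apply: lev_le; rewrite -ltnS -subSn.
    rewrite mulrA ler_pdivlMr//.
    (* A cell of time [n - h] has side more than [eps * delta / (2 * r (n - h))], and the entry is
       at least [r n / d]; [r_growth] compares the product with [5 / 4]. *)
    have := r_growth (n - h)%N; have := lev_lt (n - h)%N.
    rewrite subnK//.
    move: ri; set u := lev _; set A := `|_|; set rn := r n; set rk := r (n - h)%N.
    move=> ri lu gr.
    rewrite -(ler_pM2l ed0) -(ler_pM2l dR).
    have := ler_wpM2l (ltW (mulr_gt0 ed0 eps_gt0)) ri.
    have := ler_wpM2l (ltW dR) (ltW lu).
    by rewrite expr2 in gr *; lra.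
  have gle : #|[pred x | good k x && bad n x]|%:R <= q * #|good k|%:R.
    have B0 : (0 < 2 ^ (K - l))%N by rewrite expn_gt0.
    have BP : (2 ^ (K - l) %| P.+1)%N by rewrite PK dvdn_exp2l// leq_subr.
    apply: (fiber_count (i := i) B0 BP) => [x s sB|x].
      apply: eq_forallb => j; rewrite /bad /center_form; congr (~~ (dist_int (_ + _) < _)).
      apply: eq_bigr => t _; rewrite /dyadic_center set_low_div//.
      by rewrite dvdn_exp2l// leq_sub2l// lk.
    apply: le_trans (bad_cells_fraction PK (b n) x ln nK (e0 n) (e4 n) (ltW eps_gt0) yl) _.
    have -> : q = (1 + eps) * (2 * delta * (1 + eps)) by rewrite /q; ring.
    rewrite ler_wpM2r// ler_wpM2l ?addr_ge0 ?(ltW eps_gt0)//.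
    apply: le_trans (eS n); rewrite lerD2l ler_wpM2r ?invr_ge0 ?(ltW (pow0 _))//.
    by apply: le_trans (sum_le_r n); rewrite (bigD1 i)//= lerDl sumr_ge0.
  (* A cell lost at time [n] was good for the first [n] events, hence for the first [k <= n]. *)
  have : (#|good n| <= #|good n.+1| + #|[pred x | good k x && bad n x]|)%N.
    rewrite -cardUI (leq_trans _ (leq_addr _ _))//; apply/subset_leq_card/fintype.subsetP => x.
    rewrite !inE => /forallP gx; have [bx|nbx] := boolP (bad n x).
      apply/orP; right; rewrite andbT; apply/forallP => j.
      have jn : (j < n)%N by apply: leq_trans (ltn_ord j) _; rewrite leq_subLR -add1n leq_add2r ltnW.
      exact: (gx (Ordinal jn)).
    apply/orP; left; apply/forallP => j.
    have := ltn_ord j; rewrite ltnS leq_eqVlt => /orP[/eqP ->//|jn].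
    exact: (gx (Ordinal jn)).
  by rewrite -(ler_nat R) natrD /g; lra.
have : 0 < g m by apply: (sieve_gt0 h_gt1 q0).
rewrite ltr0n => /card_gt0P[x /forallP gx].
(* The lower corner of a surviving cell: it is within half a side of each center, so moving there
   costs at most [e n - delta]. *)
exists (\row_i ((x i)%:R / 2 ^+ K)); split => [i|n nm].
  rewrite mxE divr_ge0 ?(ltW (pow0 _))//= ler_pdivrMr// mul1r -natrX ler_nat -PK.
  exact: ltnW.
have nK : (lev n <= K)%N by apply: lev_le; exact: ltnW.
have := gx (Ordinal nm); rewrite /bad -leNgt /= => ge.
rewrite -(lerD2r (r n * (2^-1 / 2 ^+ lev n))); apply: le_trans ge _.
apply: le_trans (dist_int_lipschitz _ (affine_form (a n) (b n) (\row_i ((x i)%:R / 2 ^+ K)))) _.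
rewrite lerD2l distrC /affine_form /center_form opprD addrACA subrr addr0 -sumrB.
apply: le_trans (ler_norm_sum _ _ _) _.
apply: (@le_trans _ _ (\sum_i `|a n ord0 i| * (2^-1 / 2 ^+ lev n))).
  apply: ler_sum => i _; rewrite mxE -mulrBr normrM ler_wpM2l//.
  exact: dyadic_center_close.
by rewrite -mulr_suml ler_wpM2r// divr_ge0// ltW.
Qed.

End Core.

(** * Compactness and rescaling *)

Lemma affine_form_continuous (R : realType) (d : nat) (a : 'rV[R]_d) (b : R) :
  continuous (affine_form a b).
Proof.
move=> x; rewrite /affine_form.
have sum_cvg : (fun y : 'rV[R]_d => \sum_i a ord0 i * y ord0 i) @ x
    --> \sum_i a ord0 i * x ord0 i.
  apply: (@cvg_big R 'I_d _ _ _ add_continuous _ _ _ _ _ (nbhs_filter x)) => i _.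
  apply: (@cvgMl_tmp R _ _ (nbhs_filter x)); exact: coord_continuous.
by apply: (cvgD sum_cvg); exact: cvg_cst.
Qed.

(** The finite solutions have a cluster point in the cube; each constraint is closed and holds for
    all of them from some [m] on, so it passes to that point. *)
Lemma compact_avoidance (R : realType) (d : nat) (a : nat -> 'rV[R]_d) (b : nat -> R)
    (delta : R) :
    (forall m, exists theta : 'rV[R]_d, (forall i, 0 <= theta ord0 i <= 1) /\
      (forall n, (n < m)%N -> delta <= dist_int (affine_form (a n) (b n) theta))) ->
  exists theta : 'rV[R]_d, (forall i, 0 <= theta ord0 i <= 1) /\
    (forall n, delta <= dist_int (affine_form (a n) (b n) theta)).
Proof.
move=> /choice[f fP].
have cube_compact : compact [set v : 'rV[R]_d | forall i, `[0, 1]%classic (v ord0 i)].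
  by apply: (@rV_compact R d (fun=> `[0, 1]%classic)) => i; exact: segment_compact.
have [|z [z01 clz]] := cube_compact (f @ \oo) _.
  by exists 0%N => // m _ i; rewrite /= in_itv /=; exact: (fP m).1.
exists z; split=> [i|n]; first by have := z01 i; rewrite /= in_itv.
rewrite leNgt; apply/negP => /dist_int_lt[k zk].
pose e := delta - `|affine_form (a n) (b n) z - k%:~R|.
have e0 : 0 < e by rewrite subr_gt0.
have Uz : nbhs z [set x | `|affine_form (a n) (b n) z - affine_form (a n) (b n) x| < e].
  exact: (@cvgr_dist_lt R R^o _ (nbhs z) (nbhs_filter z) _ _
    (@affine_form_continuous R d (a n) (b n) z) _ e0).
have Vf : (f @ \oo) [set x | delta <= dist_int (affine_form (a n) (b n) x)].
  by exists n.+1 => // m nm; exact: (fP m).2.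
have [x [/= xV xU]] := clz _ _ Vf Uz.
have := dist_int_lipschitz (affine_form (a n) (b n) x) (affine_form (a n) (b n) z).
rewrite distrC; have := dist_int_le (affine_form (a n) (b n) z) k.
by move: xV xU; rewrite /e; lra.
Qed.

Lemma affine_form_scale (R : realType) (d : nat) (a : 'rV[R]_d) (b s : R)
    (c x : 'rV[R]_d) :
  affine_form (s *: a) (affine_form a b c) x = affine_form a b (c + s *: x).
Proof.
rewrite /affine_form addrA -big_split /=; congr (_ + _).
by apply: eq_bigr => i _; rewrite !mxE; ring.
Qed.

(** Substituting [c + s *: x] leads back to the unit cube with [r] multiplied by [s]. Only the lower
    bound on [r 0] is affected, the other conditions on [r] being homogeneous. *)
Lemma cube_avoidance (R : realType) (d : nat) (a : nat -> 'rV[R]_d) (b r : nat -> R)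
    (delta eps s : R) (h : nat) (c : 'rV[R]_d) :
    (1 < h)%N -> (0 < d)%N -> 0 < delta -> 0 < eps -> eps <= 1 -> 0 < s ->
    2 * delta * (1 + eps) <= 1 / 4 ->
    (forall n, \sum_i `|a n ord0 i| <= r n) ->
    (forall n, exists i, r n <= d%:R * `|a n ord0 i|) ->
    (forall n, r n <= r n.+1) ->
    5 / 4 * d%:R <= eps * (s * r 0%N) ->
    (forall n, 5 / 2 * d%:R * r n <= eps ^+ 2 * delta * r (n + h)%N) ->
    expR 1 * h%:R * (2 * delta * (1 + eps) ^+ 2) <= 1 ->
  exists theta : 'rV[R]_d,
    (forall i, c ord0 i <= theta ord0 i <= c ord0 i + s) /\
    (forall n, delta <= dist_int (affine_form (a n) (b n) theta)).
Proof.
move=> h1 d0 delta0 eps0 eps1 s0 de ar ra rS r0 rg lll.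
have norm_s n i : `|(s *: a n) ord0 i| = s * `|a n ord0 i|.
  by rewrite mxE normrM gtr0_norm.
have [|x [x01 xP]] := @compact_avoidance R d (fun n => s *: a n)
    (fun n => affine_form (a n) (b n) c) delta.
  apply: (@finite_avoidance R d _ _ (fun n => s * r n) delta eps h) => //.
  - move=> n; under eq_bigr do rewrite norm_s.
    by rewrite -mulr_sumr ler_pM2l.
  - move=> n; have [i ri] := ra n; exists i.
    by rewrite norm_s mulrCA ler_pM2l.
  - by move=> n; rewrite ler_pM2l.
  - by move=> n; rewrite mulrCA [leRHS]mulrCA ler_pM2l.
exists (c + s *: x); split=> [i|n]; last by rewrite -affine_form_scale.
have /andP[x0 x1] := x01 i; rewrite !mxE lerDl lerD2l mulr_ge0 ?(ltW s0)//=.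
by rewrite ler_piMr// ltW.
Qed.

(** * Comparing the [p]-norm with the sum and the maximum of the entries *)

(** Young's inequality with second factor [1]; [p = 1] is separate, its conjugate exponent being
    infinite. *)
Lemma young_powR (R : realType) (x p : R) : 0 <= x -> 1 <= p ->
  x <= x `^ p / p + (1 - p^-1).
Proof.
move=> x0; rewrite le_eqVlt => /orP[/eqP <-|p1].
  by rewrite powRr1// invr1 mulr1 subrr addr0.
have p0 : 0 < p by exact: lt_trans p1.
have q0 : 0 < 1 - p^-1 by rewrite subr_gt0 invf_lt1.
have := @conjugate_powR R x 1 p (1 - p^-1)^-1 x0 ler01 p0.
by rewrite invr_gt0 invrK mulr1 powR1 mul1r; apply => //; rewrite addrC subrK.
Qed.

(** [C] is [d ^ (1 - 1 / p)], read as [d] for [p = +oo]. For finite [p] the first bound is the power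
    mean inequality, and the second replaces every entry by the largest. *)
Lemma lp_norm_bounds (R : realType) (d : nat) (p : \bar R) :
    (0 < d)%N -> (1 <= p)%E ->
  exists2 C : R, 0 < C & forall a : 'rV[R]_d,
    \sum_i `|a ord0 i| <= C * lp_norm p a /\
    exists i, C * lp_norm p a <= d%:R * `|a ord0 i|.
Proof.
move=> d0; have dR : 0 < d%:R :> R by rewrite ltr0n.
have i0 : 'I_d by exact: Ordinal d0.
pose im (a : 'rV[R]_d) := [arg max_(i > i0) `|a ord0 i|]%O.
have imP (a : 'rV[R]_d) i : `|a ord0 i| <= `|a ord0 (im a)|.
  by rewrite /im; case: arg_maxP => // j _; exact.
case: p => [p| |] //.
- rewrite lee_fin => p1; have p0 : 0 < p by exact: lt_le_trans p1.
  have pN : p != 0 by rewrite gt_eqF.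
  have pV0 : 0 <= p^-1 by rewrite invr_ge0 ltW.
  exists (d%:R `^ (1 - p^-1)) => [|a]; first exact: powR_gt0.
  have dE : d%:R `^ (1 - p^-1) * d%:R `^ p^-1 = d%:R :> R.
    by rewrite -powRD ?(gt_eqF dR) ?implybT// subrK powRr1 ?(ltW dR).
  set A := \sum_i `|a ord0 i|.
  have S0 : 0 <= \sum_(i < d) `|a ord0 i| `^ p.
    by apply: sumr_ge0 => i _; exact: powR_ge0.
  split; last first.
    exists (im a); rewrite -[X in _ <= X * _]dE -mulrA ler_wpM2l ?powR_ge0//=.
    have -> : `|a ord0 (im a)| = (`|a ord0 (im a)| `^ p) `^ p^-1.
      by rewrite -powRrM mulfV// powRr1.
    rewrite -powRM ?powR_ge0 ?(ltW dR)//.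
    apply: ge0_ler_powR => //; rewrite ?nnegrE ?mulr_ge0 ?powR_ge0 ?(ltW dR)//.
    rewrite -[X in _ <= X%:R * _]card_ord mulr_natl -sumr_const.
    by apply: ler_sum => i _; apply: ge0_ler_powR; rewrite ?nnegrE// ltW.
  have [A0|A0] := leP A 0.
    by apply: le_trans A0 _; rewrite mulr_ge0 ?powR_ge0.
  set m := A / d%:R; have m0 : 0 < m by rewrite divr_gt0.
  have AE : A = d%:R * m by rewrite /m mulrC divfK// gt_eqF.
  (* summing Young's inequality over the normalized entries [|a i| / m] *)
  have key : d%:R * m `^ p <= \sum_(i < d) `|a ord0 i| `^ p.
    have H : \sum_(i < d) (`|a ord0 i| / m) <=
        \sum_(i < d) ((`|a ord0 i| / m) `^ p / p + (1 - p^-1)).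
      by apply: ler_sum => i _; apply: young_powR => //; rewrite divr_ge0// ltW.
    have B0 : 0 < m `^ p by exact: powR_gt0.
    have HA : \sum_(i < d) (`|a ord0 i| / m) = d%:R.
      by rewrite -mulr_suml -/A AE mulfK ?gt_eqF.
    have HS : \sum_(i < d) (`|a ord0 i| / m) `^ p = (\sum_(i < d) `|a ord0 i| `^ p) / m `^ p.
      rewrite mulr_suml; apply: eq_bigr => i _.
      by rewrite powRM ?invr_ge0 ?(ltW m0)// -(powR_inv1 (ltW m0)) -powRrM mulN1r powRN.
    move: H; rewrite HA big_split /= -mulr_suml HS sumr_const card_ord.
    set S := \sum_(i < d) _ => H.
    have {}H : d%:R / p <= S / m `^ p / p.
      by move: H; rewrite -[(1 - p^-1) *+ d]mulr_natl mulrBr mulr1; lra.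
    by move: H; rewrite ler_pM2r ?invr_gt0// ler_pdivlMr.
  rewrite AE -{1}dE -mulrA ler_wpM2l ?powR_ge0//=.
  have -> : m = (m `^ p) `^ p^-1 by rewrite -powRrM mulfV// powRr1// ltW.
  rewrite -powRM ?powR_ge0 ?(ltW dR)//.
  by apply: ge0_ler_powR => //; rewrite ?nnegrE ?mulr_ge0 ?powR_ge0 ?(ltW dR).
- move=> _; exists d%:R => // a; split.
    rewrite -[X in _ <= X%:R * _]card_ord mulr_natl -sumr_const.
    apply: ler_sum => i _; rewrite /lp_norm [leRHS]/Num.norm /= mx_normrE.
    exact: (le_bigmax _ (fun ij => `|a ij.1 ij.2|) (ord0, i)).
  exists (im a); rewrite ler_pM2l// /lp_norm [leLHS]/Num.norm /= mx_normrE.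
  by apply/bigmax_leP; split=> // -[u v] _ /=; rewrite ord1.
Qed.

(** * Numerical bounds and the choice of parameters *)

(** Bounds a high power by repeated squaring, rounding down each time to keep the numbers small. *)
Lemma sqr_lower (R : realDomainType) (x y z : R) :
  0 <= x -> z <= x * x -> x <= y -> z <= y ^+ 2.
Proof.
move=> x0 zx xy; apply: le_trans zx _.
by rewrite -expr2 lerXn2r ?nnegrE// (le_trans x0).
Qed.

(** The inequality [1 + x <= expR x] at [-1 / 24] and at [5 / 112], raised to the power [16]. *)
Lemma ln2_bounds (R : realType) : 2 / 3 <= ln (2 : R) <= 5 / 7.
Proof.
have pow16 (x : R) : x ^+ 16 = (((x ^+ 2) ^+ 2) ^+ 2) ^+ 2 by rewrite [16%N](_ : _ = 2 * 2 * 2 * 2)%N// !exprM.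
rewrite -[X in X && _]ler_expR -[X in _ && X]ler_expR lnK ?posrE//; apply/andP; split.
  have -> : 2 / 3 = 16 * 24^-1 :> R by field.
  rewrite expRM_natl -[24^-1]opprK expRN exprVn.
  rewrite invf_ple ?posrE ?exprn_gt0 ?expR_gt0// pow16.
  have h : 23 / 24 <= expR (- 24^-1) :> R by apply: le_trans (expR_ge1Dx _); lra.
  apply: (@sqr_lower _ (708 / 1000)); [lra|lra|].
  apply: (@sqr_lower _ (842 / 1000)); [lra|lra|].
  apply: (@sqr_lower _ (918 / 1000)); [lra|lra|].
  by apply: (@sqr_lower _ (23 / 24)); [lra|lra|].
have -> : 5 / 7 = 16 * (5 / 112) :> R by field.
rewrite expRM_natl pow16.
have h : 1 + 5 / 112 <= expR (5 / 112) :> R by exact: expR_ge1Dx.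
apply: (@sqr_lower _ (1416 / 1000)); [lra|lra|].
apply: (@sqr_lower _ (119 / 100)); [lra|lra|].
apply: (@sqr_lower _ (1091 / 1000)); [lra|lra|].
by apply: (@sqr_lower _ (1 + 5 / 112)); [lra|lra|].
Qed.

Lemma expR1_le3 (R : realType) : expR 1 <= 3 :> R.
Proof.
have -> : expR 1 = expR (6 * 6^-1) :> R by rewrite mulfV.
rewrite expRM_natl -[6^-1]opprK expRN exprVn -[3]invrK lef_pV2 ?posrE ?invr_gt0 ?exprn_gt0 ?expR_gt0//.
have h : 5 / 6 <= expR (- 6^-1) :> R by apply: le_trans (expR_ge1Dx _); lra.
apply: (@le_trans _ _ ((5 / 6) ^+ 6)); last by rewrite lerXn2r ?nnegrE ?expR_ge0.
by rewrite !exprS expr0 mulr1; lra.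
Qed.

Section Constants.
Context {R : realType}.
Variables (N d : nat).
Hypotheses (N_gt0 : (0 < N)%N) (d_gt0 : (0 < d)%N).

Let M : R := log2 (N * d)%:R + 30.
Let T : R := log2 (N * d)%:R + 4 * log2 M.

Let ln2_gt0 : 0 < ln (2 : R).
Proof. by have := ln2_bounds R; lra. Qed.

Let Nd_ge1 : 1 <= (N * d)%:R :> R.
Proof. by rewrite ler1n muln_gt0 N_gt0. Qed.

Let log2Nd_ge0 : 0 <= log2 ((N * d)%:R : R).
Proof. by apply: divr_ge0; [exact: ln_ge0|exact: ltW]. Qed.

Let M_ge30 : 30 <= M.
Proof. by rewrite /M; have := log2Nd_ge0; lra. Qed.

Let pow2_log2 (x : R) : 0 < x -> 2 `^ log2 x = x.
Proof.
move=> x0; rewrite /powR (_ : 2 == 0 = false) ?pnatr_eq0//.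
by rewrite /log2 divfK ?gt_eqF// lnK.
Qed.

Let T_ge16 : 16 <= T.
Proof.
suff : 4 <= log2 M by rewrite /T; have := log2Nd_ge0; lra.
rewrite /log2 ler_pdivlMr// mulr_natl -lnXn// ler_ln ?posrE ?exprn_gt0//.
  by rewrite !exprS expr0; have := M_ge30; lra.
by have := M_ge30; lra.
Qed.

(* The tangent of [log2] at [64]. *)
Let T_le : T <= 11 / 10 * M - 116 / 10.
Proof.
have M0 : 0 < M by have := M_ge30; lra.
have c_bounds : 7 / 5 <= (ln (2 : R))^-1 <= 3 / 2.
  have /andP[l1 l2] := ln2_bounds R.
  rewrite -[7 / 5]invrK -[3 / 2]invrK !lef_pV2 ?posrE ?invr_gt0 ?ln2_gt0//; lra.
set c := (ln 2)^-1 in c_bounds; set y := M / 64 - 1.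
have lnM_le : ln M <= 6 * ln 2 + y.
  have -> : M = 2 ^+ 6 * (1 + y) by rewrite /y !exprS expr0; field.
  have y1 : -1 < y by rewrite /y; lra.
  rewrite lnM ?posrE ?exprn_gt0//; last by lra.
  by rewrite lnXn// mulr_natl lerD2l le_ln1Dx.
have log2M : log2 M <= 6 + c * y.
  rewrite /log2 ler_pdivrMr// mulrDl mulrAC mulVf ?gt_eqF// mul1r; exact: lnM_le.
have cy : c * y <= 3 / 2 * y \/ c * y <= 7 / 5 * y.
  have [y0|y0] := leP 0 y; [left|right]; nra.
have : T = M - 30 + 4 * log2 M by rewrite /T /M; lra.
have yE : y = M / 64 - 1 by [].
by case: cy; have := M_ge30; lra.
Qed.

(** With [e <= 3] this yields [20 * e * T ^+ 3 <= M ^+ 4], which the growth condition requires. *)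
Let cube_le : 60 * T ^+ 3 <= M ^+ 4.
Proof.
have T3 : T ^+ 3 <= (11 / 10 * M - 116 / 10) ^+ 3.
  by rewrite lerXn2r ?nnegrE//; have := T_ge16; have := T_le; lra.
(* [3993 / 100] is half of [60 * (11 / 10) ^ 3], so the square matches the two leading terms of the
   difference; [M >= 30] settles the rest. *)
have sq := sqr_ge0 (M ^+ 2 - 3993 / 100 * M + 300).
have MM : 30 * M <= M ^+ 2 by rewrite expr2; have := M_ge30; nra.
by have := M_ge30; lra.
Qed.

Lemma exists_parameters : exists (eps : R) (k : nat),
  [/\ 0 < eps, eps <= 1, (1 < N * k)%N, 0 < delta R N d &
   [/\ 2 * delta R N d * (1 + eps) <= 1 / 4,
       expR 1 * (N * k)%:R * (2 * delta R N d * (1 + eps) ^+ 2) <= 1 &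
       5 / 2 * d%:R <= eps ^+ 2 * delta R N d * 2 ^+ k]].
Proof.
have T16 := T_ge16; have T0 : 0 < T by lra.
have N0 : 0 < N%:R :> R by rewrite ltr0n.
have N1 : 1 <= N%:R :> R by rewrite ler1n.
have dR : 0 < d%:R :> R by rewrite ltr0n.
have e0 : 0 < expR 1 :> R := expR_gt0 _.
have e2 : 2 <= expR 1 :> R by have := expR_ge1Dx (1 : R); lra.
(* The gap [u] of [2] to [3] below [T] costs at most a factor [8] in [2 ^+ k] and makes room for
   [1 + eps]. *)
set k := Num.truncn (T - 2).
have /andP[k1 k2] : k%:R <= T - 2 < k.+1%:R by apply: truncn_itv; lra.
rewrite -natr1 in k2; pose u := T - k%:R.
have u2 : 2 <= u by rewrite /u; lra.
have u3 : u <= 3 by rewrite /u; lra.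
have k_gt1 : (1 < k)%N by rewrite -(ltr_nat R); lra.
have deltaE : delta R N d = (2 * expR 1 * N%:R * T)^-1 by rewrite /delta div1r.
have eNT0 : 0 < 2 * expR 1 * N%:R * T by rewrite !mulr_gt0.
(* Chosen so that [k / T = 1 - 2 * eps]. *)
pose eps := u / (2 * T).
have eps0 : 0 < eps by rewrite divr_gt0//; lra.
have eps_le : eps <= 3 / 32 by rewrite ler_pdivrMr; lra.
have uE : u = 2 * T * eps by rewrite /eps; field; rewrite gt_eqF.
have delta_le : delta R N d <= 1 / 64.
  rewrite deltaE div1r lef_pV2 ?posrE//.
  have eN : 2 <= expR 1 * N%:R :> R by nra.
  have : 2 * 16 <= expR 1 * N%:R * T by apply: ler_pM.
  by lra.
have delta0 : 0 < delta R N d by rewrite deltaE invr_gt0.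
exists eps, k; split => //; first by lra.
  by rewrite (leq_trans k_gt1)// leq_pmull.
split.
- have : delta R N d * (1 + eps) <= 1 / 64 * 2 by rewrite ler_pM//; lra.
  by lra.
- have -> : expR 1 * (N * k)%:R * (2 * delta R N d * (1 + eps) ^+ 2)
      = (1 - 2 * eps) * (1 + eps) ^+ 2.
    have -> : 1 - 2 * eps = k%:R / T.
      by rewrite /eps /u; field; rewrite gt_eqF.
    by rewrite deltaE natrM; field; rewrite !gt_eqF.
  (* This is [1 - (1 - 2 * eps) * (1 + eps) ^+ 2]. *)
  have : 0 <= eps ^+ 2 * (3 + 2 * eps) by rewrite mulr_ge0 ?sqr_ge0//; lra.
  by lra.
(* Two to the power [T] is [N * d * M ^+ 4], and two to the power [u] is at most
   [4 * (u - 1) <= u ^+ 2]. *)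
- have pow : (N * d)%:R * M ^+ 4 <= 2 ^+ k * u ^+ 2.
    have M0 : 0 < M by have := M_ge30; lra.
    have Nd0 : 0 < (N * d)%:R :> R by have := Nd_ge1; lra.
    have -> : (N * d)%:R * M ^+ 4 = 2 `^ T.
      rewrite /T -{1}(pow2_log2 Nd0) powRD ?pnatr_eq0 ?implybT//; congr (_ * _).
      by rewrite mulrC powRrM pow2_log2// powR_mulrn// ltW.
    have -> : T = k%:R + (2 + (u - 2)) by rewrite /u; lra.
    rewrite powRD ?pnatr_eq0 ?implybT// (@powRD _ _ 2) ?pnatr_eq0 ?implybT//.
    rewrite !powR_mulrn// ler_pM2l ?exprn_gt0//.
    (* convexity of [2 ^ v] on [0, 1] *)
    have v1 : 2 `^ (u - 2) <= 1 + (u - 2).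
      have [->|uN2] := eqVneq u 2; first by rewrite subrr powRr0 addr0.
      have v0 : 0 < u - 2 by rewrite subr_gt0 lt_neqAle eq_sym uN2.
      have := @young_powR R (2 `^ (u - 2)) (u - 2)^-1 (powR_ge0 _ _).
      rewrite -powRrM mulfV ?gt_eqF// powRr1// invrK.
      have h : 1 <= (u - 2)^-1 by rewrite invr_ge1 ?unitfE ?gt_eqF//; lra.
      by move=> /(_ h); lra.
    apply: (@le_trans _ _ (2 ^+ 2 * (1 + (u - 2)))); first by rewrite ler_pM2l// exprn_gt0.
    have := sqr_ge0 (u - 2); lra.
  have -> : eps ^+ 2 * delta R N d * 2 ^+ k
      = (2 ^+ k * u ^+ 2) / (8 * expR 1 * N%:R * T ^+ 3).
    by rewrite deltaE /eps; move: (2 ^+ k : R) => pk; field; rewrite !gt_eqF.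
  rewrite ler_pdivlMr ?mulr_gt0 ?exprn_gt0//; apply: le_trans pow.
  have h : expR 1 * T ^+ 3 <= 3 * T ^+ 3 by rewrite ler_pM2r ?exprn_gt0// expR1_le3.
  have cube := cube_le.
  have : N%:R * d%:R * (20 * (expR 1 * T ^+ 3)) <= N%:R * d%:R * M ^+ 4.
    by rewrite ler_pM2l ?mulr_gt0//; lra.
  by rewrite natrM; lra.
Qed.

End Constants.

(** * Deduction of the two claims *)

Theorem theorem1 (R : realType) (d : nat) (p : \bar R)
    (a : nat -> 'rV[R]_d) (b : nat -> R) (N : nat)
    (d_gt0 : (0 < d)%N) (p_ge1 : (1 <= p)%E)
    (R0_gt0 : 0 < lp_norm p (a 0%N))
    (R_nondecreasing : forall n : nat, lp_norm p (a n) <= lp_norm p (a n.+1))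
    (N_gt0 : (0 < N)%N)
    (R_growth : forall n : nat, 2 <= lp_norm p (a (n + N)%N) / lp_norm p (a n)) :
  [set theta : 'rV[R]_d |
    delta R N d <= inf (range (fun n : nat => dist_int (affine_form (a n) (b n) theta)))]
    !=set0 /\
  dense [set theta : 'rV[R]_d |
    delta R N d <= limn_inf (fun n : nat => dist_int (affine_form (a n) (b n) theta))].

Proof.
have [C C0 CP] := lp_norm_bounds d_gt0 p_ge1.
have [eps [k [eps0 eps1 h1 del0 [del_eps lll gr]]]] := @exists_parameters R N d N_gt0 d_gt0.
pose r n := C * lp_norm p (a n).
have lp_gt0 n : 0 < lp_norm p (a n).
  by elim: n => // n IH; exact: lt_le_trans (R_nondecreasing n).
have r_gt0 n : 0 < r n by exact: mulr_gt0.
(* Each block of [N] indices doubles [r], so [h = N * k] gains the factor [2 ^+ k]. *)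
have r_double n j : 2 ^+ j * r n <= r (n + N * j)%N.
  elim: j => [|j IH]; first by rewrite expr0 mul1r muln0 addn0.
  apply: (@le_trans _ _ (2 * r (n + N * j)%N)).
    by rewrite exprS -mulrA ler_pM2l.
  have -> : (n + N * j.+1 = n + N * j + N)%N by rewrite mulnS addnCA addnC.
  rewrite /r mulrCA ler_pM2l//.
  by have := R_growth (n + N * j)%N; rewrite ler_pdivlMr.
have avoid (n0 : nat) (s : R) (c : 'rV[R]_d) : 0 < s ->
    5 / 4 * d%:R <= eps * (s * r n0) ->
    exists theta : 'rV[R]_d, (forall i, c ord0 i <= theta ord0 i <= c ord0 i + s) /\
      forall n, delta R N d <= dist_int (affine_form (a (n0 + n)%N) (b (n0 + n)%N) theta).
  move=> s0 r_large.
  apply: (@cube_avoidance R d (fun n => a (n0 + n)%N) (fun n => b (n0 + n)%N)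
    (fun n => r (n0 + n)%N) (delta R N d) eps s (N * k)) => //.
  - by move=> n; exact: (CP _).1.
  - by move=> n; exact: (CP _).2.
  - by move=> n; rewrite addnS ler_pM2l.
  - by rewrite addn0.
  - move=> n /=; apply: (@le_trans _ _ (eps ^+ 2 * delta R N d * 2 ^+ k * r (n0 + n)%N)).
      by rewrite ler_pM2r.
    rewrite addnA -[leLHS]mulrA ler_pM2l; first exact: r_double.
    by rewrite mulr_gt0 ?exprn_gt0.
split.
  (* This side turns the size condition into an equality. *)
  have [||theta [_ thetaP]] := avoid 0%N (5 / 4 * d%:R / (eps * r 0%N)) 0.
  - by rewrite divr_gt0 ?mulr_gt0 ?ltr0n.
  - by rewrite mulrCA divfK// mulf_neq0// gt_eqF.
  exists theta; apply: lb_le_inf; first by exists (dist_int (affine_form (a 0%N) (b 0%N) theta)), 0%N.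
  by move=> _ [n _ <-]; exact: thetaP.
move=> O [x Ox] oO.
have [e /= e0 xeO] : nbhs_ball x O by apply/nbhs_ballP; exact: open_nbhs_nbhs.
set s := e / 2; have s0 : 0 < s by rewrite divr_gt0.
(* In a small cube the size condition holds only from a late index on, reached because
   [2 ^ j > j]. *)
have [j rj] : exists j, 5 / 4 * d%:R <= eps * (s * r (N * j)%N).
  have y0 : 0 < eps * (s * r 0%N) by rewrite !mulr_gt0.
  pose j := (Num.truncn (5 / 4 * d%:R / (eps * (s * r 0%N)))).+1; exists j.
  apply: (@le_trans _ _ (eps * (s * (2 ^+ j * r 0%N)))); last first.
    rewrite ler_pM2l// ler_pM2l//; exact: (r_double 0%N j).
  rewrite [s * _]mulrCA [leRHS]mulrCA -ler_pdivrMr//.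
  apply: ltW; apply: lt_le_trans (truncnS_gt _) _.
  by rewrite -/j -natrX ler_nat ltnW// ltn_expl.
have [theta [xtheta thetaP]] := avoid (N * j)%N s x s0 rj.
exists theta; split.
  apply: xeO; split => // i l; rewrite ord1 /ball /=.
  have := xtheta l; rewrite ltr_norml /s; lra.
pose u n := dist_int (affine_form (a n) (b n) theta).
have u01 n : 0 <= u n <= 1 by rewrite dist_int_ge0 dist_int_le1.
have lb_u n : has_lbound (sdrop u n).
  by exists 0 => _ [m _ <-]; have /andP[] := u01 m.
change (delta R N d <= limn_inf u); rewrite limn_infE; last first.
  exists 1; split => // M M1 n _ /=.
  by have /andP[u0 u1] := u01 n; rewrite ger0_norm//; exact: le_trans (ltW M1).
(* The lower limit is the supremum of the tail infima; the tail from [N * j] already gives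
   [delta]. *)
apply: (@le_trans _ _ (infs u (N * j)%N)).
  apply: lb_le_inf; first by exists (u (N * j)%N), (N * j)%N => /=.
  by move=> _ [n /= jn <-]; have := thetaP (n - N * j)%N; rewrite subnKC.
apply: ub_le_sup; last by exists (N * j)%N.
exists 1 => _ [n _ <-]; apply: (@le_trans _ _ (u n)); last by have /andP[] := u01 n.
by apply: ge_inf => //; exists n => /=.
Qed.
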